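(* Let $p\ge1$, $I\in\mathbb N_{>0}$, $\alpha_i\in(0,1)$ for $i\in[I]$, $g\in\mathbb R^\ell$, let $\mathcal X\subset\mathbb R^\ell$ be closed and convex, and let $\Xi\subset\mathbb R^d=\mathbb R^{d_1}\times\cdots\times\mathbb R^{d_n}$ be closed. Let $Q=\sum_{l=1}^M\vartheta_l\delta_{\xi^l}$ be a discrete distribution with atoms $\xi^1,\ldots,\xi^M\in\Xi$ and masses $\vartheta_1,\ldots,\vartheta_M$, and let $\bm\varepsilon=(\varepsilon_1,\ldots,\varepsilon_n)\succeq0$. Suppose that the functions $f_i:\mathcal X\times\Xi\to\mathbb R$, $i\in[I]$, are such that: for each $i\in[I]$ and $\xi\in\Xi$, the function $x\mapsto f_i(x,\xi)$ is convex; and there exists $r\in[0,p)$ such that for each $i\in[I]$ and $x\in\mathcal X$ the function $\xi\mapsto f_i(x,\xi)$ is continuous and belongs to $\mathcal G_r$. Then the distributionally robust CVaR-constrained problem $$\begin{aligned}\inf_{x\in\mathcal X}\ &\langle g,x\rangle\\ \text{s.t.}\ &\sup_{P\in\mathcal T_p(Q,\bm\varepsilon)}\inf_{\tau\in\mathbb R}\mathbb E_P[(f_i(x,\xi)+\tau)_+-\tau\alpha_i]\le0,\quad i\in[I],\end{aligned}$$ is equivalent to the convex program $$\begin{aligned}\inf_{x\in\mathcal X,\,\tau_i,\,\bm\lambda_i,\,s_{li}}\ &\langle g,x\rangle\\ \text{s.t.}\ \ &\sum_{k=1}^n\lambda_{ki}\varepsilon_k^p+\sum_{l=1}^M\vartheta_l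 s_{li}\le\tau_i\alpha_i,&& i\in[I],\\ &\sup_{\xi\in\Xi}\Big\{f_i(x,\xi)+\tau_i-\sum_{k=1}^n\lambda_{ki}\|\xi_k-\xi_k^l\|^p\Big\}\le s_{li},&& l\in[M],\ i\in[I],\\ &s_{li}\ge0,&& l\in[M],\ i\in[I],\end{aligned}$$ with variables $x\in\mathcal X$, $\tau_i\in\mathbb R$, $\bm\lambda_i=(\lambda_{1i},\ldots,\lambda_{ni})\succeq0$, and $s_{li}\in\mathbb R$.
   Context: ''Equivalent'' means that $x\in\mathcal X$ is feasible for the first problem if and only if it can be completed by the auxiliary variables to a feasible point of the second (so the optimal values coincide). Notation: $[N]:=\{1,\ldots,N\}$; $x_+:=\max\{x,0\}$; for vectors, $\succeq0$ means all components are nonnegative; elements of $\mathbb R^d$ are written $\xi=(\xi_1,\ldots,\xi_n)$ with $\xi_k\in\mathbb R^{d_k}$ (so $\xi^l_k$ is the $k$th block of the atom $\xi^l$), and each $\mathbb R^{d_k}$ (and $\mathbb R^d$) carries an arbitrary norm denoted $\|\cdot\|$. $\mathcal P(\cdot)$ denotes Borel probability measures. $\mathcal G_r$ is the class of functions $h:\Xi\to\mathbb R$ for which there are $C>0$ and $\zeta\in\Xi$ such that $h(\xi)\le C(1+\|\zeta-\xi\|^r)$ for all $\xi\in\Xi$, and likewise for $-h$. The multi-transport hyperrectangle is $$\mathcal T_p(Q,\bm\varepsilon):=\Big\{\mathrm{pr}_{2\#}\pi:\ \pi\in\mathcal P(\Xi\times\Xi),\ \mathrm{pr}_{1\#}\pi=Q,\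 \int_{\Xi\times\Xi}\|\zeta_k-\xi_k\|^p\,d\pi(\zeta,\xi)\le\varepsilon_k^p\ \text{for all }k\in[n]\Big\},$$ where $\mathrm{pr}_{1\#}\pi,\mathrm{pr}_{2\#}\pi$ are the first and second marginals of $\pi$.
   Formalization: The equivalence with real multipliers is stated only when all ε_k > 0, since it can fail when some ε_k = 0; for general ε ⪰ 0 it is stated with multipliers λ_{ki} in [0,+∞] and +∞·0 = 0. The masses ϑ_l are taken to be strictly positive. *)

(* Defs.v *)
From HB Require Import structures.
From mathcomp Require Import all_boot all_order all_algebra.
From mathcomp Require Import all_classical all_reals all_analysis.

Set Implicit Arguments.
Unset Strict Implicit.
Unset Printing Implicit Defensive.

Import Order.TTheory GRing.Theory Num.Theory.
Import numFieldNormedType.Exports.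

Local Open Scope classical_set_scope.
Local Open Scope ring_scope.

(* Nonnegativity follows from the three axioms. *)
Definition is_norm (R : realType) (V : lmodType R) (N : V -> R) : Prop :=
  [/\ forall v, N v = 0 -> v = 0,
      forall a v, N (a *: v) = `|a| * N v
    & forall u v, N (u + v) <= N u + N v].

(* The type T with its Borel sigma-algebra.  On 'rV[R]_m the product
   sigma-algebra of borel * borel is the Borel sigma-algebra of the product. *)
Notation borel T := (g_sigma_algebraType (@open T)).

(* R^d = R^(d 0) x ... x R^(d (n-1)), as concatenated row vectors; the k-th
   block of xi is submxrow xi k. *)
Notation blockvec R d := ('rV[R]_(\sum_k d k)).

Definition discrete_law (R : realType) (m M : nat)
    (w : 'I_M -> R) (a : 'I_M -> 'rV[R]_m) (A : set 'rV[R]_m) : \bar R :=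
  (\sum_l (w l)%:E * \d_(a l : borel 'rV[R]_m) A)%E.

(* The class G_r of functions on Xi; values of h outside Xi are irrelevant. *)
Definition growth_class (R : realType) (V : lmodType R) (N : V -> R)
    (Xi : set V) (r : R) (h : V -> R) : Prop :=
  let bounded_above (h : V -> R) :=
    exists C : R, exists zeta : V, [/\ 0 < C, Xi zeta &
      forall xi, Xi xi -> h xi <= C * (1 + N (zeta - xi) `^ r)] in
  bounded_above h /\ bounded_above (fun xi => - h xi).

(* Borel probabilities on Xi (resp. Xi x Xi) are identified with those on the
   ambient space that give mass one to Xi (resp. Xi x Xi). *)
Definition multi_transport (R : realType) (n : nat) (d : 'I_n -> nat)
    (Nb : forall k, 'rV[R]_(d k) -> R) (Xi : set (blockvec R d)) (p : R)
    (Q : set (blockvec R d) -> \bar R) (eps : 'I_n -> R) :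
    set (probability (borel (blockvec R d)) R) :=
  [set P | exists pi :
      probability (borel (blockvec R d) * borel (blockvec R d))%type R,
    [/\ pi (Xi `*` Xi) = 1%E,
        forall A, measurable A -> pushforward pi fst A = Q A,
        forall A, measurable A -> pushforward pi snd A = P A
      & forall k : 'I_n,
          (\int[pi]_(z in Xi `*` Xi)
             (Nb k (submxrow (z.1 : blockvec R d) k
                    - submxrow (z.2 : blockvec R d) k) `^ p)%:E
           <= (eps k `^ p)%:E)%E]].

(* inf_tau E_P[(h + tau)_+ - tau * alpha], for P concentrated on Xi *)
Definition cvar_functional (R : realType) (m : nat) (Xi : set 'rV[R]_m)
    (P : probability (borel 'rV[R]_m) R) (h : 'rV[R]_m -> R) (alpha : R) :
    \bar R :=
  ereal_inf [set (\int[P]_(xi in Xi)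
                    (Num.max (h xi + tau) 0 - tau * alpha)%:E)%E
            | tau in [set: R]].

Definition dr_cvar_feasible (R : realType) (m q I : nat)
    (X : set 'rV[R]_q) (Xi : set 'rV[R]_m)
    (ambiguity : set (probability (borel 'rV[R]_m) R))
    (f : 'I_I -> 'rV[R]_q -> 'rV[R]_m -> R) (alpha : 'I_I -> R) :
    set 'rV[R]_q :=
  [set x | X x /\ forall i : 'I_I,
    (ereal_sup [set cvar_functional Xi P (f i x) (alpha i)
               | P in ambiguity] <= 0)%E].

Definition program_feasible (R : realType) (n : nat) (d : 'I_n -> nat)
    (q I M : nat) (Nb : forall k, 'rV[R]_(d k) -> R)
    (X : set 'rV[R]_q) (Xi : set (blockvec R d)) (p : R)
    (eps : 'I_n -> R) (w : 'I_M -> R) (a : 'I_M -> blockvec R d)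
    (f : 'I_I -> 'rV[R]_q -> blockvec R d -> R) (alpha : 'I_I -> R) :
    set ('rV[R]_q * 'rV[R]_I * 'M[R]_(n, I) * 'M[R]_(M, I)) :=
  fun z => let: (x, tau, lam, s) := z in
    [/\ X x,
        forall k i, 0 <= lam k i,
        forall i, \sum_k lam k i * eps k `^ p + \sum_l w l * s l i
                  <= tau 0 i * alpha i,
        forall l i,
          (ereal_sup [set (f i x xi + tau 0 i
              - \sum_k lam k i
                  * Nb k (submxrow xi k - submxrow (a l) k) `^ p)%:E
            | xi in Xi] <= (s l i)%:E)%E
      & forall l i, 0 <= s l i].

(* program_feasible with multipliers in [0, +oo] and +oo * 0 = 0.  If eps k > 0
   the first constraint forces lam k i to be finite, so this only differs from
   program_feasible when some eps k = 0.  There, a finite optimal multiplier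
   need not exist: for Xi = R, Q = \d_0, eps = 0, p = 1, X = {0} and
   f = Num.sqrt `|xi|, x = 0 is feasible for the CVaR problem (the ambiguity
   set is {Q}), but a real feasible point would have tau = s = 0 and
   Num.sqrt `|xi| <= lam * `|xi| for all xi. *)
Definition extended_program_feasible (R : realType) (n : nat)
    (d : 'I_n -> nat) (q I M : nat) (Nb : forall k, 'rV[R]_(d k) -> R)
    (X : set 'rV[R]_q) (Xi : set (blockvec R d)) (p : R)
    (eps : 'I_n -> R) (w : 'I_M -> R) (a : 'I_M -> blockvec R d)
    (f : 'I_I -> 'rV[R]_q -> blockvec R d -> R) (alpha : 'I_I -> R) :
    set ('rV[R]_q * 'rV[R]_I * 'M[\bar R]_(n, I) * 'M[R]_(M, I)) :=
  fun z => let: (x, tau, lam, s) := z in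
    [/\ X x,
        forall k i, (0 <= lam k i)%E,
        forall i, (\sum_k lam k i * (eps k `^ p)%:E
                     + (\sum_l w l * s l i)%:E
                   <= (tau 0%R i * alpha i)%:E)%E,
        forall l i,
          (ereal_sup [set ((f i x xi + tau 0%R i)%:E
              - \sum_k lam k i
                  * (Nb k (submxrow xi k - submxrow (a l) k) `^ p)%:E)%E
            | xi in Xi] <= (s l i)%:E)%E
      & forall l i, 0 <= s l i].

(* Minimization of obj over F is equivalent to that of obj \o proj over G: the
   points of F are exactly those that can be completed to a point of G, and
   the optimal values coincide. *)
Definition equivalent_problems (R : realType) (V W : Type) (obj : V -> R)
    (F : set V) (proj : W -> V) (G : set W) : Prop :=
  (forall x, F x <-> exists2 z, G z & proj z = x) /\
  ereal_inf [set (obj x)%:E | x in F] =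
  ereal_inf [set (obj (proj z))%:E | z in G].

(* Main.v *)
(* For fixed x and i, any dual point bounds the CVaR by integrating its pointwise
   inequality against a transport plan; since Q is discrete, the plan charges only
   finitely many values of the first coordinate.  Conversely, consider selections
   of one point of Xi for each atom (agreeing with the atom on the blocks with
   eps k = 0).  The constraints L(selection; tau, lam) <= 0 on (tau, lam) are
   closed and convex, and the selection consisting of the atoms themselves makes
   them compact.  If they are inconsistent, so are finitely many of them, and a
   convex combination of these selections is then a discrete distribution in the
   ambiguity set with positive CVaR functional. *)
Require Import Defs.
From HB Require Import structures.
From mathcomp Require Import all_boot all_order all_algebra.
From mathcomp Require Import all_classical all_reals all_analysis.
From mathcomp Require Import finmap measurable_realfun ring lra.

Set Implicit Arguments.
Unset Strict Implicit.
Unset Printing Implicit Defensive.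

Import Order.TTheory GRing.Theory Num.Theory.
Import numFieldNormedType.Exports.

Local Open Scope classical_set_scope.
Local Open Scope ring_scope.

(** * Alternatives for systems of convex inequalities *)

Lemma continuous_sumr (R : realType) (T : topologicalType) (J : finType)
    (F : J -> T -> R) :
  (forall j, continuous (F j)) -> continuous (fun x => \sum_j F j x).
Proof.
by move=> Fc; apply: continuous_big => [|j _]; [exact: add_continuous|].
Qed.

(** The squared positive part has derivative [2 * Num.max x 0], which is 2-Lipschitz, so its
    first-order remainder is at most [y ^+ 2]. *)
Lemma sqr_maxD_le (R : realType) (x y : R) :
  Num.max (x + y) 0 ^+ 2 <= Num.max x 0 ^+ 2 + 2 * Num.max x 0 * y + y ^+ 2.
Proof.
have xy2 := sqr_ge0 (x + y); have y2 := sqr_ge0 y.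
rewrite /Num.max; have [x0|x0] := ltP x 0; have [xy0|xy0] := ltP (x + y) 0.
- by nra.
- have : 0 <= - x * (y + (x + y)) by apply: mulr_ge0; lra.
  by nra.
- by nra.
- by nra.
Qed.

(** For small [s] the linear term dominates, so a negative slope would make the expression negative.
    This extracts a first-order condition without differentiating. *)
Lemma quadratic_slope_ge0 (R : realType) (b c : R) :
  (forall s, 0 < s <= 1 -> 0 <= s * b + s ^+ 2 * c) -> 0 <= b.
Proof.
move=> H; rewrite leNgt; apply/negP => b0.
(* With this choice [s * c <= - b / 2], so [b + s * c] stays negative. *)
pose s := Num.min 1 (- b / (2 * (`|c| + 1))).
have c1 : 0 < 2 * (`|c| + 1) by rewrite mulr_gt0// ltr_wpDl.
have s0 : 0 < s by rewrite lt_min ltr01/= divr_gt0// oppr_gt0.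
have s1 : s <= 1 by rewrite ge_min lexx.
have := H s; rewrite s0 s1 => /(_ isT).
have sb : s * (2 * (`|c| + 1)) <= - b.
  by rewrite -ler_pdivlMr// ge_min lexx orbT.
have cc : c <= `|c| := ler_norm c.
have : s * (b + s * c) < 0; last by move=> *; nra.
by rewrite pmulr_rlt0//; nra.
Qed.

(* The multipliers come from the minimum over C of the sum of the squared
   positive parts of the F j: the first-order condition at the minimizer y says
   that the combination with weights (F j y)_+ is at least the minimum. *)
Lemma finite_convex_alternative (R : realType) (V : normedModType R)
    (C : set V) (J : finType) (F : J -> V -> R) (j0 : J) :
  closed C -> C !=set0 ->
  (forall x y s, C x -> C y -> 0 <= s <= 1 -> C (x + s *: (y - x))) ->
  (forall j, continuous (F j)) ->
  (forall j x y s, C x -> C y -> 0 <= s <= 1 ->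
     F j (x + s *: (y - x)) <= F j x + s * (F j y - F j x)) ->
  (forall B, exists2 K : set V,
     compact K & forall y, C y -> F j0 y <= B -> K y) ->
  (exists2 y, C y & forall j, F j y <= 0) \/
  (exists v : J -> R, exists e, [/\ forall j, 0 <= v j, \sum_j v j = 1, 0 < e &
     forall y, C y -> e <= \sum_j v j * F j y]).
Proof.
move=> Ccl [y0 Cy0] Ccvx Fcont Fcvx Fcoer.
pose P j y := Num.max (F j y) 0.
pose G y := \sum_j P j y ^+ 2.
have P0 j y : 0 <= P j y by rewrite /P le_max lexx orbT.
have G0 y : 0 <= G y by apply: sumr_ge0 => j _; exact: sqr_ge0.
have Pcont j : continuous (P j).
  move=> y; apply: continuous_max => //; [exact: Fcont|exact: cst_continuous].
have Gcont : continuous G.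
  apply: continuous_sumr => j y.
  under eq_fun do rewrite expr2.
  by apply: cvgM; exact: Pcont.
(* Since [t <= 1 + t ^+ 2], this bound makes [K] contain every point of [C] where [G] is at most
   [G y0]. *)
have [K Kc FK] := Fcoer (1 + G y0).
have FG y : G y <= G y0 -> F j0 y <= 1 + G y0.
  move=> yy0; have : P j0 y ^+ 2 <= G y0.
    apply: le_trans yy0; rewrite /G (bigD1 j0)//= lerDl.
    by apply: sumr_ge0 => j _; exact: sqr_ge0.
  have : F j0 y <= P j0 y by rewrite /P le_max lexx.
  have := P0 j0 y; have := sqr_ge0 (P j0 y - 1); nra.
have KCc : compact (K `&` C) by exact: compact_closedI.
have [||y /set_mem[Ky Cy] ymin] := @compact_EVT_min _ _ G _ _ KCc.
- by exists y0; split => //; apply: FK => //; exact: FG.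
- exact: continuous_subspaceT.
(* Where [G] exceeds [G y0] there is nothing to compare, so the minimum over the compact part is a
   minimum over all of [C]. *)
have {}ymin z : C z -> G y <= G z.
  move=> Cz; have [zy0|/ltW zy0] := leP (G z) (G y0).
    by apply: ymin; apply/mem_set; split => //; apply: FK => //; exact: FG.
  by apply: le_trans zy0; apply: ymin; apply/mem_set; split => //;
    apply: FK => //; exact: FG.
have [Gy|Gy] := eqVneq (G y) 0.
  left; exists y => // j.
  have : P j y ^+ 2 == 0.
    by move/eqP: Gy; rewrite psumr_eq0 => [/allP/(_ j)|? _];
      [apply; rewrite mem_index_enum|exact: sqr_ge0].
  by rewrite sqrf_eq0 => /eqP Pj; rewrite -Pj /P le_max lexx.
right; have {}Gy : 0 < G y by rewrite lt_neqAle eq_sym Gy G0.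
pose S := \sum_j P j y.
have S0 : 0 < S.
  rewrite lt_neqAle sumr_ge0// andbT eq_sym; apply: contraTneq Gy => /eqP.
  rewrite psumr_eq0// => /allP S0; rewrite -leNgt /G big1// => j _.
  by have /implyP/(_ isT)/eqP -> := S0 j (mem_index_enum _); rewrite expr0n.
exists (fun j => P j y / S), (G y / S); split => //.
- by move=> j; rewrite divr_ge0// ltW.
- by rewrite -mulr_suml divff// gt_eqF.
- by rewrite divr_gt0.
move=> z Cz.
under eq_bigr do rewrite mulrAC; rewrite -mulr_suml ler_pM2r ?invr_gt0//.
(* By this identity the weighted combination takes the value [G y / S] at [y]; it remains to see
   that it is no smaller at [z]. *)
have PF j : P j y * F j y = P j y ^+ 2.
  by rewrite /P /Num.max; case: ltP => _; rewrite ?mul0r ?expr0n// expr2.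
suff : 0 <= 2 * \sum_j P j y * (F j z - F j y).
  rewrite pmulr_rge0//; under eq_bigr do rewrite mulrBr PF.
  by rewrite sumrB subr_ge0.
(* Along the segment from [y] to [z], convexity of the [F j] and [sqr_maxD_le] bound the growth of
   [G] by a quadratic in [s], and minimality makes that growth nonnegative. *)
apply: (@quadratic_slope_ge0 _ _ (\sum_j (F j z - F j y) ^+ 2)) => s /andP[s0 s1].
have s01 : 0 <= s <= 1 by rewrite (ltW s0).
have := ymin _ (Ccvx _ _ _ Cy Cz s01); rewrite -subr_ge0 => /le_trans; apply.
rewrite /G -sumrB !mulr_sumr -big_split/=; apply: ler_sum => j _.
have := Fcvx j _ _ _ Cy Cz s01.
have := sqr_maxD_le (F j y) (s * (F j z - F j y)).
rewrite -/(P j y) => + Fle.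
have : P j (y + s *: (z - y)) <= Num.max (F j y + s * (F j z - F j y)) 0.
  by rewrite /P ge_max !le_max Fle lexx orbT.
have := P0 j (y + s *: (z - y)); set p1 := P j _; set p2 := Num.max _ 0.
by move=> *; nra.
Qed.

(** Compactness reduces to finitely many inequalities: if every finite subfamily is solvable, so is
    the whole by the finite intersection property; otherwise [finite_convex_alternative] applies to
    an unsolvable one. The index [t0] is added to each finite subfamily because it carries the
    coercivity. *)
Lemma convex_alternative (R : realType) (V : normedModType R) (C : set V)
    (T : choiceType) (D : set T) (F : T -> V -> R) (t0 : T) : D t0 ->
  closed C -> C !=set0 ->
  (forall x y s, C x -> C y -> 0 <= s <= 1 -> C (x + s *: (y - x))) ->
  (forall t, continuous (F t)) ->
  (forall t x y s, C x -> C y -> 0 <= s <= 1 ->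
     F t (x + s *: (y - x)) <= F t x + s * (F t y - F t x)) ->
  (forall B, exists2 K : set V,
     compact K & forall y, C y -> F t0 y <= B -> K y) ->
  (exists2 y, C y & forall t, D t -> F t y <= 0) \/
  (exists (J : finType) (ts : J -> T) (v : J -> R) (e : R),
    [/\ forall j, D (ts j), forall j, 0 <= v j, \sum_j v j = 1, 0 < e &
     forall y, C y -> e <= \sum_j v j * F (ts j) y]).
Proof.
move=> Dt0 Ccl C0 Ccvx Fcont Fcvx Fcoer.
have Fcl t : closed [set y | F t y <= 0].
  by apply: (@closed_comp _ _ (F t) [set x | x <= 0]) => [y _|];
    [exact: Fcont|exact: closed_le].
have [K Kc FK] := Fcoer 0.
pose K0 := K `&` (C `&` [set y | F t0 y <= 0]).
have K0c : compact K0 by apply: compact_closedI => //; exact: closedI.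
have [allF|notallF] := pselect (forall A : {fset T}, {subset A <= D} ->
    exists2 y, C y & forall t, t \in t0 |` A -> F t y <= 0)%fset.
  left; move: K0c; rewrite compact_In0 => /(_ T D (fun t => K0 `&` [set y | F t y <= 0])).
  case.
  - by exists (fun t => [set y | F t y <= 0]).
  - move=> A AD; have [y Cy yF] := allF A AD; exists y => t tA.
    have yt0 : F t0 y <= 0 by apply: yF; rewrite in_fset1U eqxx.
    split; last by apply: yF; rewrite in_fset1U (_ : t \in A) ?orbT.
    by split; [exact: FK|split].
  move=> y yP; exists y => [|t Dt]; first by have [[_ []]] := yP _ Dt0.
  by have [] := yP _ Dt.
right; apply: contrapT => H; apply: notallF => A AD.
have t0A : t0 \in (t0 |` A)%fset by rewrite in_fset1U eqxx.
have [[y Cy yF]|[v [e [v0 v1 e0 ve]]]] :=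
  @finite_convex_alternative R V C (t0 |` A)%fset (fun t => F (val t))
    [` t0A]%fset Ccl C0 Ccvx (fun j => Fcont (val j)) (fun j => Fcvx (val j))
    Fcoer.
  by exists y => // t tA; exact: (yF [` tA]%fset).
exfalso; apply: H; exists (t0 |` A)%fset, val, v, e; split => // j.
have := valP j; rewrite in_fset1U => /predU1P[->//|/AD].
exact: set_mem.
Qed.

(** * The Lagrangian over selections and its duality *)

(* xi selects one point for each atom, y = (tau, lam), and e k = eps k ^ p; the
   variables s l of the program are the suprema over xi l of the inner terms. *)
Definition lagrangian (R : realType) (n M : nat) (S : Type) (w : 'I_M -> R)
    (h : S -> R) (c : 'I_n -> 'I_M -> S -> R) (e : 'I_n -> R) (alpha : R)
    (xi : 'I_M -> S) (y : R * 'rV[R]_n) : R :=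
  \sum_l w l * (Num.max (h (xi l) + y.1) 0 - \sum_k y.2 0 k * c k l (xi l))
  + \sum_k y.2 0 k * e k - y.1 * alpha.

Lemma lagrangian_continuous (R : realType) (n M : nat) (S : Type)
    (w : 'I_M -> R) (h : S -> R) (c : 'I_n -> 'I_M -> S -> R) (e : 'I_n -> R)
    (alpha : R) (xi : 'I_M -> S) :
  continuous (lagrangian w h c e alpha xi).
Proof.
have cfst : continuous (fun y : R * 'rV[R]_n => y.1) by move=> y; exact: cvg_fst.
have csnd k : continuous (fun y : R * 'rV[R]_n => y.2 0 k).
  move=> y; apply: (@continuous_comp _ _ _ snd (fun v : 'rV[R]_n => v 0 k)).
    exact: cvg_snd.
  exact: coord_continuous.
have csum (b : 'I_n -> R) :
    continuous (fun y : R * 'rV[R]_n => \sum_k y.2 0 k * b k).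
  by apply: continuous_sumr => k y; apply: cvgM; [exact: csnd|exact: cvg_cst].
have csel : continuous (fun y : R * 'rV[R]_n => \sum_l w l *
    (Num.max (h (xi l) + y.1) 0 - \sum_k y.2 0 k * c k l (xi l))).
  apply: continuous_sumr => l y; apply: cvgM; first exact: cvg_cst.
  apply: cvgB; last exact: (csum (fun k => c k l (xi l))).
  apply: (@continuous_max R _ (fun z : R * 'rV[R]_n => h (xi l) + z.1)
    (fun=> 0) y); last exact: cst_continuous.
  by apply: cvgD; [exact: cvg_cst|exact: cfst].
move=> y; apply: cvgB; last by apply: cvgM; [exact: cfst|exact: cvg_cst].
by apply: cvgD; [exact: csel|exact: csum].
Qed.

Lemma lagrangian_convex (R : realType) (n M : nat) (S : Type)
    (w : 'I_M -> R) (h : S -> R) (c : 'I_n -> 'I_M -> S -> R) (e : 'I_n -> R)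
    (alpha : R) (xi : 'I_M -> S) (x y : R * 'rV[R]_n) (s : R) :
  (forall l, 0 <= w l) -> 0 <= s <= 1 ->
  lagrangian w h c e alpha xi (x + s *: (y - x)) <=
  lagrangian w h c e alpha xi x + s *
    (lagrangian w h c e alpha xi y - lagrangian w h c e alpha xi x).
Proof.
move=> w0 /andP[s0 s1]; rewrite /lagrangian /=.
have snd k : (x.2 + s *: (y.2 - x.2)) 0 k = (1 - s) * x.2 0 k + s * y.2 0 k.
  by rewrite !mxE; ring.
have lin (b : 'I_n -> R) : \sum_k (x.2 + s *: (y.2 - x.2)) 0 k * b k =
    (1 - s) * (\sum_k x.2 0 k * b k) + s * (\sum_k y.2 0 k * b k).
  rewrite !mulr_sumr -big_split/=; apply: eq_bigr => k _; rewrite snd; ring.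
rewrite lin; set A := \sum_l w l * _; set B := \sum_l w l * _.
set D := \sum_l w l * _.
suff : A <= (1 - s) * B + s * D.
  have -> : s *: (y.1 - x.1) = s * (y.1 - x.1) by [].
  set ex := \sum_k _; set ey := \sum_k _; nra.
rewrite /A /B /D !mulr_sumr -big_split/=; apply: ler_sum => l _.
rewrite lin; have -> : s *: (y.1 - x.1) = s * (y.1 - x.1) by [].
rewrite mulrCA (mulrCA s) -mulrDr ler_wpM2l//.
set cx := \sum_k _; set cy := \sum_k _.
suff : Num.max (h (xi l) + (x.1 + s * (y.1 - x.1))) 0 <=
   (1 - s) * Num.max (h (xi l) + x.1) 0 + s * Num.max (h (xi l) + y.1) 0.
  by move=> ?; lra.
have s1' : 0 <= 1 - s by rewrite subr_ge0.
have X1 : h (xi l) + x.1 <= Num.max (h (xi l) + x.1) 0 by rewrite le_max lexx.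
have X2 : 0 <= Num.max (h (xi l) + x.1) 0 by rewrite le_max lexx orbT.
have Y1 : h (xi l) + y.1 <= Num.max (h (xi l) + y.1) 0 by rewrite le_max lexx.
have Y2 : 0 <= Num.max (h (xi l) + y.1) 0 by rewrite le_max lexx orbT.
move: X1 X2 Y1 Y2; set mx := Num.max _ _; set my := Num.max _ _ => X1 X2 Y1 Y2.
rewrite ge_max; apply/andP; split; last by rewrite addr_ge0// mulr_ge0.
have := ler_wpM2l s1' X1; have := ler_wpM2l s0 Y1; lra.
Qed.

(** At the atoms the costs vanish. Bounding the mean hinge below by 0 gives the lower bound on
    [tau], bounding it by [H + tau] gives the upper bound because [alpha < 1], and what remains of
    [B] bounds each [lam k * e k]. *)
Lemma lagrangian_coercive (R : realType) (n M : nat) (S : Type)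
    (w : 'I_M -> R) (h : S -> R) (c : 'I_n -> 'I_M -> S -> R) (e : 'I_n -> R)
    (alpha : R) (a : 'I_M -> S) (B : R) :
  (forall l, 0 <= w l) -> \sum_l w l = 1 -> 0 < alpha < 1 ->
  (forall k, 0 <= e k) -> (forall k l, c k l (a l) = 0) ->
  exists2 K : set (R * 'rV[R]_n), compact K &
    forall y : R * 'rV[R]_n, (forall k, 0 <= y.2 0 k) -> (forall k, e k = 0 -> y.2 0 k = 0) ->
      lagrangian w h c e alpha a y <= B -> K y.
Proof.
move=> w0 w1 /andP[alpha0 alpha1] e0 ca.
pose H := \sum_l w l * h (a l).
pose T := (B - H) / (1 - alpha).
exists (`[- B / alpha, T]%classic `*`
        [set v : 'rV[R]_n | forall k, `[0, (B + T * alpha) / e k]%classic (v 0 k)]).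
  apply: compact_setX; first exact: segment_compact.
  apply: (rV_compact (A := fun k => `[0, (B + T * alpha) / e k]%classic)) => k.
  exact: segment_compact.
case=> t v /= v0 ve; rewrite /lagrangian /=.
have ca0 l : \sum_k v 0 k * c k l (a l) = 0.
  by apply: big1 => k _; rewrite ca mulr0.
under [X in X + _ - _]eq_bigr do rewrite ca0 subr0.
set m := \sum_l _; set E := \sum_k _ => LB.
have m0 : 0 <= m.
  by apply: sumr_ge0 => l _; rewrite mulr_ge0// le_max lexx orbT.
have mH : H + t <= m.
  rewrite -[t]mul1r -w1 mulr_suml -big_split/=; apply: ler_sum => l _.
  by rewrite -mulrDr ler_wpM2l// le_max lexx.
have E0 : 0 <= E by apply: sumr_ge0 => k _; rewrite mulr_ge0.
have tT : t <= T by rewrite ler_pdivlMr ?subr_gt0//; nra.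
split; first by rewrite in_itv/= tT andbT ler_pdivrMr//; nra.
move=> k; rewrite in_itv/= v0/=.
(* Division by zero yields 0, so for [e k = 0] the interval is the single point 0, as required. *)
have [ek0|ek0] := eqVneq (e k) 0; first by rewrite ek0 ve// invr0 mulr0.
rewrite ler_pdivlMr ?lt_neqAle 1?eq_sym ?ek0 ?e0//.
have : v 0 k * e k <= E.
  by rewrite /E (bigD1 k)//= lerDl sumr_ge0// => j _; rewrite mulr_ge0.
have : t * alpha <= T * alpha by rewrite ler_pM2r.
lra.
Qed.

(* If the lagrangian at (tau, lam) is nonpositive for every selection of points,
   then the suprema over the individual points can be taken separately. *)
Lemma lagrangian_suprema (R : realType) (n M : nat) (S : Type)
    (Xi_ : 'I_M -> set S) (w : 'I_M -> R) (h : S -> R)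
    (c : 'I_n -> 'I_M -> S -> R) (e : 'I_n -> R)
    (alpha : R) (a : 'I_M -> S) (y : R * 'rV[R]_n) :
  (forall l, 0 < w l) -> \sum_l w l = 1 ->
  (forall k l, c k l (a l) = 0) -> (forall l, Xi_ l (a l)) ->
  (forall xi, (forall l, Xi_ l (xi l)) -> lagrangian w h c e alpha xi y <= 0) ->
  exists s : 'I_M -> R, [/\ forall l, 0 <= s l,
    \sum_k y.2 0 k * e k + \sum_l w l * s l <= y.1 * alpha
  & forall l xi, Xi_ l xi -> h xi + y.1 - \sum_k y.2 0 k * c k l xi <= s l].
Proof.
move=> w0 w1 ca Xia Lxi.
(* Keeping the positive part here makes the value at each atom nonnegative, hence also the
   suprema. *)
pose val l xi := Num.max (h xi + y.1) 0 - \sum_k y.2 0 k * c k l xi.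
have val_a l : 0 <= val l (a l).
  rewrite /val big1 ?subr0 ?le_max ?lexx ?orbT// => k _; by rewrite ca mulr0.
pose E l := [set val l xi | xi in Xi_ l].
set b := y.1 * alpha - \sum_k y.2 0 k * e k.
have Lval xi : (forall l, Xi_ l (xi l)) -> \sum_l w l * val l (xi l) <= b.
  by move=> /Lxi; rewrite /lagrangian /b /val; lra.
have E_ub l : ubound (E l) (b / w l).
  move=> _ [x Xx <-]; rewrite ler_pdivlMr// mulrC.
  pose xi l' := if l' == l then x else a l'.
  have xil : xi l = x by rewrite /xi eqxx.
  have := @Lval xi; rewrite (bigD1 l)//= xil => H.
  apply: le_trans (H _); last first.
    by move=> l'; rewrite /xi; case: eqP => [->|].
  rewrite lerDl sumr_ge0// => l' /negbTE l'l; rewrite /xi l'l.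
  by rewrite mulr_ge0// ltW.
have E_sup l : has_sup (E l).
  by split; [exists (val l (a l)), (a l)|exists (b / w l)].
have Es l xi : Xi_ l xi -> val l xi <= sup (E l).
  by move=> Xx; apply: ub_le_sup; [exact: (E_sup l).2|exists xi].
exists (fun l => sup (E l)); split.
- by move=> l; apply: le_trans (val_a l) _; exact: Es.
(* Choose points within [d] of each supremum; as the weights sum to 1, the total loss is exactly
   [d]. *)
- rewrite addrC -lerBrDr -/b; apply/ler_addgt0Pr => d d0.
  have /choice[xi xiP] l : exists x, Xi_ l x /\ sup (E l) - d < val l x.
    by have [_ [x Xx <-] ?] := sup_adherent d0 (E_sup l); exists x.
  have /Lval : forall l, Xi_ l (xi l) by move=> l; have [] := xiP l.
  move=> Lb; rewrite -lerBlDr; apply: le_trans Lb; rewrite -[d]mul1r -w1 mulr_suml -sumrB.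
  apply: ler_sum => l _; rewrite -mulrBr ler_wpM2l ?(ltW (w0 l))//.
  by have [_ /ltW] := xiP l.
- move=> l xi /Es Ex; apply: le_trans Ex; rewrite /val.
  by rewrite lerD2r le_max lexx.
Qed.

(** If no [(tau, lam)] satisfies all constraints, [convex_alternative] yields a mixture of
    selections whose averaged Lagrangian is at least some [d > 0]. Large multipliers then show that
    the mixture respects the transport budgets, and zero multipliers contradict the primal
    hypothesis. *)
Lemma selection_duality (R : realType) (n M : nat) (S : choiceType)
    (Xi_ : 'I_M -> set S) (w : 'I_M -> R) (h : S -> R)
    (c : 'I_n -> 'I_M -> S -> R) (e : 'I_n -> R)
    (alpha : R) (a : 'I_M -> S) :
  (forall l, 0 < w l) -> \sum_l w l = 1 -> 0 < alpha < 1 ->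
  (forall k, 0 <= e k) ->
  (forall k l, c k l (a l) = 0) -> (forall l, Xi_ l (a l)) ->
  (forall k, e k = 0 -> forall l xi, Xi_ l xi -> c k l xi = 0) ->
  (forall (J : finType) (v : J -> R) (xi : J -> 'I_M -> S),
     (forall j, 0 <= v j) -> \sum_j v j = 1 ->
     (forall j l, Xi_ l (xi j l)) ->
     (forall k, \sum_j v j * (\sum_l w l * c k l (xi j l)) <= e k) ->
     forall d, 0 < d -> exists tau,
       \sum_j v j * (\sum_l w l * Num.max (h (xi j l) + tau) 0)
       - tau * alpha < d) ->
  exists (tau : R) (lam : 'I_n -> R) (s : 'I_M -> R),
    [/\ forall k, 0 <= lam k, forall l, 0 <= s l,
    \sum_k lam k * e k + \sum_l w l * s l <= tau * alpha
  & forall l xi, Xi_ l xi -> h xi + tau - \sum_k lam k * c k l xi <= s l].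
Proof.
move=> w0 w1 alpha01 e0 ca Xia c0 Hprimal.
have w0' l : 0 <= w l by exact: ltW.
(* Selections become finite functions because [convex_alternative] indexes its constraints by a
   [choiceType]. *)
pose T : choiceType := {ffun 'I_M -> S}.
(* A multiplier with [e k = 0] would be unbounded. Fixing it at 0 changes nothing, since on
   admissible points its cost vanishes. *)
pose C := [set y : R * 'rV[R]_n | (forall k, 0 <= y.2 0 k) /\
  (forall k, e k = 0 -> y.2 0 k = 0)].
pose F (xi : T) := lagrangian w h c e alpha xi.
pose aT : T := [ffun l => a l].
have FaT : F aT = lagrangian w h c e alpha a.
  by rewrite /F (_ : (aT : _ -> _) = a)//; apply/funext => l; rewrite ffunE.
have csnd k : continuous (fun y : R * 'rV[R]_n => y.2 0 k).
  move=> y; apply: (@continuous_comp _ _ _ snd (fun v : 'rV[R]_n => v 0 k)).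
    exact: cvg_snd.
  exact: coord_continuous.
have Ccl : closed C.
  rewrite (_ : C = (\bigcap_k ((fun y : R * 'rV[R]_n => y.2 0 k) @^-1` [set t | 0 <= t]))
     `&` (\bigcap_(k in [set k | e k = 0])
        ((fun y : R * 'rV[R]_n => y.2 0 k) @^-1` [set 0]))); last first.
    apply/seteqP; split => y [y0 ye]; split => k.
    - by move=> _; exact: y0.
    - exact: ye.
    - exact: (y0 k Logic.I).
    - exact: ye.
  apply: closedI; apply: closed_bigI => k _; apply: closed_comp => [y _|].
  - exact: csnd.
  - exact: closed_ge.
  - exact: csnd.
  - exact: closed_eq.
have Ccvx x y s : C x -> C y -> 0 <= s <= 1 -> C (x + s *: (y - x)).
  move=> [x0 xe] [y0 ye] /andP[s0 s1].
  have snd k : (x + s *: (y - x)).2 0 k = (1 - s) * x.2 0 k + s * y.2 0 k.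
    by rewrite /= !mxE; ring.
  split => k; rewrite snd; last by move=> ek; rewrite xe// ye// !mulr0 addr0.
  by rewrite addr_ge0// mulr_ge0// subr_ge0.
have DaT : [set xi : T | forall l, Xi_ l (xi l)] aT by move=> l; rewrite ffunE.
have C0 : C !=set0 by exists 0; split => k *; rewrite mxE.
have Fcont t : continuous (F t) by exact: lagrangian_continuous.
have Fcvx t x y s : C x -> C y -> 0 <= s <= 1 ->
    F t (x + s *: (y - x)) <= F t x + s * (F t y - F t x).
  by move=> _ _; exact: lagrangian_convex.
have Fcoer B : exists2 K : set (R * 'rV[R]_n),
    compact K & forall y, C y -> F aT y <= B -> K y.
  have [K Kc KP] := lagrangian_coercive h B w0' w1 alpha01 e0 ca.
  by exists K => // y [y0 ye]; rewrite FaT; exact: KP.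
have [[y [y0 ye] Ly]|] := convex_alternative DaT Ccl C0 Ccvx Fcont Fcvx Fcoer.
  have [|s [s0 sle sP]] := @lagrangian_suprema R n M S Xi_ w h c e alpha a y w0 w1 ca Xia.
    move=> xi Xxi; have := Ly [ffun l => xi l]; rewrite /F.
    rewrite (_ : ([ffun l => xi l] : T) = xi :> (_ -> _)).
      by apply => l; rewrite ffunE.
    by apply/funext => l; rewrite ffunE.
  by exists y.1, (fun k => y.2 0 k), s.
move=> [J [ts [v [d [Xts v0 v1 d0 Fd]]]]]; exfalso.
pose u k := \sum_j v j * (\sum_l w l * c k l (ts j l)).
pose Phi tau := \sum_j v j * (\sum_l w l * Num.max (h (ts j l) + tau) 0)
       - tau * alpha.
(* The averaged Lagrangian separates into the CVaR objective [Phi] in [tau] and a linear form in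
   [lam] whose coefficients are the budget slacks. *)
have FE y : \sum_j v j * F (ts j) y = Phi y.1 + \sum_k y.2 0 k * (e k - u k).
  transitivity (\sum_j (v j * (\sum_l w l * Num.max (h (ts j l) + y.1) 0)
     - \sum_k y.2 0 k * (v j * \sum_l w l * c k l (ts j l))
     + v j * (\sum_k y.2 0 k * e k) - v j * (y.1 * alpha))).
    apply: eq_bigr => j _; rewrite /F /lagrangian.
    under eq_bigr do rewrite mulrBr; rewrite sumrB.
    under [X in _ - X + _ - _]eq_bigr do rewrite mulr_sumr.
    rewrite exchange_big/=.
    rewrite (_ : \sum_k y.2 0 k * (v j * _) = v j * \sum_k y.2 0 k *
      \sum_l w l * c k l (ts j l)); last first.
      by rewrite mulr_sumr; apply: eq_bigr => k _; rewrite mulrCA.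
    rewrite (_ : \sum_k y.2 0 k * \sum_l _ =
      \sum_k \sum_l w l * (y.2 0 k * c k l (ts j l))); last first.
      apply: eq_bigr => k _; rewrite mulr_sumr; apply: eq_bigr => l _.
      by rewrite mulrCA.
    ring.
  rewrite !big_split/= !sumrN -!mulr_suml v1 !mul1r.
  rewrite exchange_big/=.
  rewrite (_ : \sum_k \sum_j _ = \sum_k y.2 0 k * u k); last first.
    by apply: eq_bigr => k _; rewrite mulr_sumr.
  under [in RHS]eq_bigr do rewrite mulrBr; rewrite sumrB /Phi; ring.
have ule k : u k <= e k.
  have [ek0|ek0] := eqVneq (e k) 0.
    rewrite ek0 /u big1// => j _; rewrite big1 ?mulr0// => l _.
    by rewrite c0 ?mulr0//; exact: Xts.
  rewrite leNgt; apply/negP => eu.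
  (* On a block with violated budget this multiplier brings the averaged Lagrangian at [tau = 0]
     down to at most -1, below [d]. *)
  pose m := (`|Phi 0| + 1) / (u k - e k).
  have m0 : 0 <= m by rewrite divr_ge0 ?subr_ge0 ?(ltW eu)// addr_ge0.
  have /Fd : C (0, m *: delta_mx 0 k).
    split => j; rewrite !mxE eqxx/=; first by rewrite mulr_ge0// ler0n.
    by move=> ej; case: eqP => [jk|]; [rewrite -jk ej eqxx in ek0|rewrite mulr0].
  rewrite FE /= (bigD1 k)//= big1 => [|j jk]; last first.
    by rewrite !mxE eqxx (negbTE jk) /= mulr0 mul0r.
  rewrite !mxE !eqxx mulr1 addr0 -opprB mulrN /m divfK ?gt_eqF ?subr_gt0//.
  by have := ler_norm (Phi 0); lra.
have [tau tauP] := Hprimal J v (fun j l => ts j l) v0 v1 Xts ule d d0.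
have /Fd : C (tau, 0) by split => k *; rewrite mxE.
rewrite FE /= big1 ?addr0 => [|k _]; last by rewrite mxE mul0r.
by rewrite leNgt tauP.
Qed.

(** * Borel measurability and integration against discrete laws *)

(** Expanding [u - v] in the standard basis bounds the variation of [psi] by [G], a weighted sum of
    coordinate distances that tends to 0. This relates arbitrary norms on the blocks to the standard
    topology. *)
Lemma seminorm_continuous (R : realType) (m : nat) (psi : 'rV[R]_m -> R) :
  (forall a v, psi (a *: v) = `|a| * psi v) ->
  (forall u v, psi (u + v) <= psi u + psi v) -> continuous psi.
Proof.
move=> psiZ psiD v.
pose G u := \sum_j `|(u - v) 0 j| * psi 'e_j.
have psi_sum (I : Type) (r : seq I) (F : I -> 'rV[R]_m) :
    psi (\sum_(i <- r) F i) <= \sum_(i <- r) psi (F i).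
  elim/big_ind2 : _ => //; last by move=> *; exact: le_trans (psiD _ _) (lerD _ _).
  by rewrite -(scale0r 0) psiZ normr0 mul0r.
have psiN u : psi (- u) = psi u by rewrite -scaleN1r psiZ normrN1 mul1r.
have psiG u : psi (u - v) <= G u.
  rewrite [in leLHS](row_sum_delta (u - v)); apply: le_trans (psi_sum _ _ _) _.
  by apply: ler_sum => j _; rewrite psiZ.
have psiB u : `|psi v - psi u| <= G u.
  have := psiD u (v - u); rewrite subrKC -opprB psiN.
  have := psiD v (u - v); rewrite subrKC; have := psiG u.
  by rewrite ler_norml => *; apply/andP; split; lra.
have Gc : continuous G.
  apply: continuous_sumr => j u.
  apply: (@continuousM R _ (fun u : 'rV[R]_m => `|(u - v) 0 j|)
    (fun=> psi 'e_j) u).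
    apply: (@continuous_comp _ _ _ (fun u : 'rV[R]_m => (u - v) 0 j)
      (fun t : R => `|t|)); last exact: (@norm_continuous _ R^o).
    have -> : (fun u : 'rV[R]_m => (u - v) 0 j) = (fun u => u 0 j - v 0 j).
      by apply/funext => z; rewrite !mxE.
    apply: (@continuousB _ _ _ (fun z : 'rV[R]_m => z 0 j) (fun=> v 0 j) u).
      exact: coord_continuous.
    exact: cst_continuous.
  exact: cst_continuous.
apply/(@cvgrPdist_lt _ _ _ (nbhs v) _ psi) => e e0.
have : \forall u \near v, G u < e.
  apply: (@cvgr_lt _ _ (nbhs v) _ G (G v)); first exact: Gc.
  by rewrite /G big1// => j _; rewrite subrr mxE normr0 mul0r.
by apply: filterS => u; exact: le_lt_trans.
Qed.

Lemma within_continuous_borel_measurable (R : realType) (T : ptopologicalType)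
    (D : set T) (f : T -> R) :
  measurable (D : set (borel T)) -> {within D, continuous f} ->
  measurable_fun (D : set (borel T)) (f : borel T -> R).
Proof.
move=> mD /continuousP cf.
apply: (measurability _ (measurable_realfun.RGenOpens.measurableE R)) => _ [_ [a [b ->] <-]].
have /open_subspaceP[V oV VD] : open (from_subspace D f @^-1` `]a, b[%classic).
  by apply: cf; exact: interval_open.
rewrite setIC -VD; apply: measurableI => //.
exact: sub_sigma_algebra.
Qed.

Lemma closed_borel_measurable (T : ptopologicalType) (D : set T) :
  closed D -> measurable (D : set (borel T)).
Proof.
move=> cD; rewrite -[D]setCK; apply: measurableC.
by apply: sub_sigma_algebra; exact: closed_openC.
Qed.

(** A preimage is a finite union of rectangles with a singleton side. Thus measurability in the
    second variable suffices for the transport cost once the first runs over the atoms. *)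
Lemma measurable_fun_finite_fst d1 d2 (T1 : measurableType d1)
    (T2 : measurableType d2) d3 (T3 : measurableType d3) (A : set T1)
    (D : set T2) (F : T1 * T2 -> T3) :
  finite_set A -> (forall b, A b -> measurable [set b]) -> measurable D ->
  (forall b, A b -> measurable_fun D (fun x => F (b, x))) ->
  measurable_fun (A `*` D) F.
Proof.
move=> finA mA mD mF _ Y mY.
rewrite (_ : _ `&` _ =
  \bigcup_(b in A) ([set b] `*` (D `&` (fun x => F (b, x)) @^-1` Y))).
  apply: fin_bigcup_measurable => // b Ab; apply: measurableX; first exact: mA.
  exact: mF.
apply/seteqP; split => [[b x] [[/= Ab Dx] FY]|[b x] [c Ac [/= -> [Dx FY]]]].
  by exists b.
by [].
Qed.

(** A simple function below [f] on [D] is also below [g] on [D'], and the integrals are suprema over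
    such functions. The argument covers integrands not known to be measurable. *)
Lemma ge0_integral_subset_le d (T : measurableType d) (R : realType)
    (mu : {measure set T -> \bar R}) (D D' : set T) (f g : T -> \bar R) :
  (forall x, D x -> D' x /\ (f x <= g x)%E) ->
  (forall x, D x -> 0 <= f x)%E -> (forall x, D' x -> 0 <= g x)%E ->
  (\int[mu]_(x in D) f x <= \int[mu]_(x in D') g x)%E.
Proof.
move=> fg f0 g0; rewrite !ge0_integralE//.
apply: ereal_sup_le => _ [h hf <-]; exists h => // x /=.
apply: le_trans (hf x) _; rewrite /patch.
have [|_] := boolP (x \in D); last first.
  by have [|] := boolP (x \in D') => [/set_mem/g0|].
by move=> /set_mem /fg[/mem_set -> ].
Qed.

Lemma discrete_measure_exists d (T : measurableType d) (R : realType)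
    (J : finType) (v : J -> R) (pt : J -> T) :
  (forall j, 0 <= v j) ->
  exists2 mu : {measure set T -> \bar R},
    forall A, mu A = (\sum_j (v j)%:E * \d_(pt j) A)%E &
    forall (D : set T) (f : T -> \bar R), measurable D -> measurable_fun D f ->
      (forall x, D x -> 0 <= f x)%E ->
      (\int[mu]_(x in D) f x = \sum_j (v j)%:E * (\d_(pt j) D * f (pt j)))%E.
Proof.
move=> v0.
(* [msum] takes a sequence indexed by [nat], so [J] is enumerated; the zero measure past [#|J|] is a
   default that is never summed. *)
pose m_ (k : nat) : {measure set T -> \bar R} :=
  if insub k is Some i then
    mscale (NngNum (v0 (enum_val (i : 'I_#|J|)))) \d_(pt (enum_val i))
  else mzero.
have m_E (i : 'I_#|J|) : m_ i =
    mscale (NngNum (v0 (enum_val i))) \d_(pt (enum_val i)).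
  by rewrite /m_ valK.
exists (msum m_ #|J|).
  move=> A; rewrite -[LHS]/(\sum_(k < #|J|) m_ k A)%E.
  rewrite [RHS](reindex _ (onW_bij _ (enum_val_bij J)))/=.
  by apply: eq_bigr => i _; rewrite m_E.
move=> D f mD mf f0; rewrite ge0_integral_measure_sum//.
under eq_bigr do rewrite m_E ge0_integral_mscale// integral_dirac//.
by rewrite [RHS](reindex _ (onW_bij _ (enum_val_bij J))).
Qed.

Lemma discrete_integral d (T : measurableType d) (R : realType)
    (J : finType) (v : J -> R) (pt : J -> T) (mu : {measure set T -> \bar R}) :
  (forall j, 0 <= v j) ->
  (forall A, measurable A -> mu A = \sum_j (v j)%:E * \d_(pt j) A)%E ->
  forall (D : set T) (f : T -> \bar R), measurable D -> measurable_fun D f ->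
    (forall x, D x -> 0 <= f x)%E ->
    (\int[mu]_(x in D) f x = \sum_j (v j)%:E * (\d_(pt j) D * f (pt j)))%E.
Proof.
move=> v0 muE D f mD mf f0.
have [nu nuE nuf] := discrete_measure_exists pt v0.
rewrite -nuf//; apply: eq_measure_integral => A mA _.
by rewrite muE.
Qed.

Lemma measurable_fun_finite_set d1 d2 (T1 : measurableType d1)
    (T2 : measurableType d2) (A : set T1) (f : T1 -> T2) :
  finite_set A -> (forall x, A x -> measurable [set x]) -> measurable_fun A f.
Proof.
move=> finA mA _ Y _.
rewrite (_ : _ `&` _ = \bigcup_(x in A `&` f @^-1` Y) [set x]).
  by apply: fin_bigcup_measurable => [|x [Ax _]];
    [exact: finite_setIl|exact: mA].
by rewrite bigcup_imset1 image_id.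
Qed.

(* f need not be measurable: it is dominated by the measurable function equal
   to f on the atoms and to +oo elsewhere. *)
Lemma discrete_integral_le d (T : measurableType d) (R : realType)
    (J : finType) (v : J -> R) (pt : J -> T) (mu : {measure set T -> \bar R})
    (D : set T) (f : T -> \bar R) :
  (forall j, 0 <= v j) -> (forall j, measurable [set pt j]) ->
  (forall A, measurable A -> mu A = \sum_j (v j)%:E * \d_(pt j) A)%E ->
  (forall x, 0 <= f x)%E ->
  (\int[mu]_(x in D) f x <= \sum_j (v j)%:E * f (pt j))%E.
Proof.
move=> v0 mpt muE f0.
have finA : finite_set (range pt) by exact: finite_image.
have mA x : range pt x -> measurable [set x] by move=> [j _ <-].
have mR : measurable (range pt).
  rewrite -bigcup_imset1.
  exact: fin_bigcup_measurable.
pose g x := if x \in range pt then f x else +oo%E.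
have g0 x : (0 <= g x)%E by rewrite /g; case: ifP => // _; rewrite leey.
have mg : measurable_fun setT g.
  apply: measurable_fun_if => //.
  - by apply: (measurable_fun_bool true); rewrite setTI preimage_mem_true.
  - by rewrite setTI preimage_mem_true; exact: measurable_fun_finite_set.
apply: (@le_trans _ _ (\int[mu]_(x in setT) g x)%E).
  apply: ge0_integral_subset_le => // x _; split => //.
  by rewrite /g; case: ifP => // _; rewrite leey.
rewrite (discrete_integral v0 muE)//; apply: lee_sum => j _.
by rewrite diracT mul1e /g mem_set.
Qed.

Lemma discrete_probability_exists d (T : measurableType d) (R : realType)
    (J : finType) (v : J -> R) (pt : J -> T) :
  (forall j, 0 <= v j) -> \sum_j v j = 1 ->
  exists P : probability T R,
    forall A, P A = (\sum_j (v j)%:E * \d_(pt j) A)%E.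
Proof.
move=> v0 v1; have [mu muE _] := discrete_measure_exists pt v0.
have mu1 : mu setT = 1%E.
  rewrite muE; under eq_bigr do rewrite diracT mule1.
  by rewrite sumEFin v1.
(* Normalizing a measure of mass 1 leaves it unchanged and supplies the probability structure; the
   Dirac mass is only a default. *)
exists (mnormalize mu (dirac point)) => A.
rewrite -muE /= /mnormalize [X in X == 0%E]mu1 [X in fine X]mu1 onee_eq0 /=.
by rewrite [X in X == +oo%E]mu1/= invr1 mule1.
Qed.

Lemma ge0_integral_image_law d1 d2 (X : measurableType d1)
    (Y : measurableType d2) (R : realType) (phi : X -> Y)
    (mu : {measure set X -> \bar R}) (nu : {measure set Y -> \bar R})
    (D : set Y) (f : Y -> \bar R) :
  measurable_fun setT phi ->
  (forall A, measurable A -> pushforward mu phi A = nu A) ->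
  measurable D -> measurable_fun D f -> (forall y, D y -> 0 <= f y)%E ->
  (\int[nu]_(y in D) f y = \int[mu]_(x in phi @^-1` D) (f (phi x)))%E.
Proof.
move=> mphi munu mD mf f0.
rewrite -(ge0_integral_pushforward mphi mu mD mf); last first.
  by move=> y /set_mem; exact: f0.
apply/esym; apply: eq_measure_integral => //.
by move=> A mA _; exact: munu.
Qed.

(** The integrand of [cvar_functional] may change sign. Detaching the constant leaves the
    nonnegative hinge, to which the nonnegative integration lemmas apply. *)
Lemma probability_integral_shift d (T : measurableType d) (R : realType)
    (P : probability T R) (D : set T) (G : T -> R) (b : R) :
  measurable D -> P D = 1%E -> measurable_fun D G ->
  (forall x, D x -> 0 <= G x) -> (\int[P]_(x in D) (G x)%:E < +oo)%E ->
  (\int[P]_(x in D) (G x - b)%:E = \int[P]_(x in D) (G x)%:E - b%:E)%E.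
Proof.
move=> mD PD mG G0 Goo.
have iG : P.-integrable D (EFin \o G).
  apply/integrableP; split; first exact/measurable_EFinP.
  rewrite (_ : \int[P]_(x in D) _ = \int[P]_(x in D) (G x)%:E)%E//.
  by apply: eq_integral => x /set_mem Dx /=; rewrite ger0_norm// G0.
have ib : P.-integrable D (EFin \o (fun=> b)).
  by apply: finite_measure_integrable_cst.
under eq_integral do rewrite EFinB.
rewrite integralB_EFin//.
have := integral_cst P mD b%:E.
by rewrite [X in (_ = _ * X)%E -> _]PD mule1 /= => ->.
Qed.

(** * Norms on the blocks and transport costs *)

Lemma is_norm_distC (R : realType) (V : lmodType R) (N : V -> R) (u v : V) :
  is_norm N -> N (u - v) = N (v - u).
Proof. by case=> _ NZ _; rewrite -opprB -(scaleN1r (v - u)) NZ normrN1 mul1r. Qed.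

Lemma is_norm0 (R : realType) (V : lmodType R) (N : V -> R) :
  is_norm N -> N 0 = 0.
Proof. by case=> _ NZ _; rewrite -(scale0r 0) NZ normr0 mul0r. Qed.

Lemma is_norm_ge0 (R : realType) (V : lmodType R) (N : V -> R) (v : V) :
  is_norm N -> 0 <= N v.
Proof.
move=> hN; have [_ NZ ND] := hN; have := ND v (- v).
by rewrite subrr is_norm0// -(scaleN1r v) NZ normrN1 mul1r; lra.
Qed.

Lemma measurable_borel_set1 (R : realType) (m : nat) (b : 'rV[R]_m) :
  measurable ([set b] : set (borel 'rV[R]_m)).
Proof.
apply: closed_borel_measurable; apply: accessible_closed_set1.
exact/hausdorff_accessible/norm_hausdorff.
Qed.

Definition block_cost (R : realType) (n : nat) (d : 'I_n -> nat)
    (Nb : forall k, 'rV[R]_(d k) -> R) (p : R) (k : 'I_n)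
    (zeta xi : blockvec R d) : R :=
  Nb k (submxrow zeta k - submxrow xi k) `^ p.

Lemma block_cost_continuous (R : realType) (n : nat) (d : 'I_n -> nat)
    (Nb : forall k, 'rV[R]_(d k) -> R) (k : 'I_n) (zeta : blockvec R d) :
  is_norm (Nb k) ->
  continuous (fun xi : blockvec R d => Nb k (submxrow zeta k - submxrow xi k)).
Proof.
move=> [_ NZ ND].
(* On the whole space the norm of one block is in general only a seminorm, since it ignores the
   other blocks. *)
pose psi (v : blockvec R d) := Nb k (submxrow v k).
have psic : continuous psi.
  apply: seminorm_continuous => [s v|u v]; rewrite /psi.
    by rewrite -NZ; congr (Nb k _); apply/rowP => j; rewrite !mxE.
  apply: le_trans (ND _ _); rewrite le_eqVlt; apply/orP; left; apply/eqP.
  by congr (Nb k _); apply/rowP => j; rewrite !mxE.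
have -> : (fun xi : blockvec R d => Nb k (submxrow zeta k - submxrow xi k)) =
    psi \o (fun xi => zeta - xi).
  apply/funext => xi; rewrite /psi /=.
  by congr (Nb k _); apply/rowP => j; rewrite !mxE.
move=> xi; apply: continuous_comp; last exact: psic.
apply: (@continuousB _ _ _ (fun=> zeta) id xi); first exact: cst_continuous.
exact: cvg_id.
Qed.

Lemma block_cost_measurable (R : realType) (n : nat) (d : 'I_n -> nat)
    (Nb : forall k, 'rV[R]_(d k) -> R) (p : R) (k : 'I_n)
    (zeta : blockvec R d) (Xi : set (blockvec R d)) :
  is_norm (Nb k) -> closed Xi ->
  measurable_fun (Xi : set (borel (blockvec R d)))
    (fun xi : borel (blockvec R d) => (block_cost Nb p k zeta xi)%:E).
Proof.
move=> hNk cXi; apply/measurable_EFinP.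
have mN : measurable_fun (Xi : set (borel (blockvec R d)))
    (fun xi : borel (blockvec R d) => Nb k (submxrow zeta k - submxrow xi k)).
  apply: within_continuous_borel_measurable; first exact: closed_borel_measurable.
  by apply: continuous_subspaceT => x; exact: block_cost_continuous.
exact: (measurableT_comp (@measurable_powR R p) mN).
Qed.

Lemma hinge_measurable (R : realType) (m : nat) (Xi : set 'rV[R]_m)
    (h : 'rV[R]_m -> R) (tau : R) :
  closed Xi -> {within Xi, continuous h} ->
  measurable_fun (Xi : set (borel 'rV[R]_m))
    (fun xi : borel 'rV[R]_m => Num.max (h xi + tau) 0).
Proof.
move=> cXi ch; apply: measurable_maxr => //; apply: measurable_funD => //.
by apply: within_continuous_borel_measurable; first exact: closed_borel_measurable.
Qed.

Lemma discrete_law_sum1 (R : realType) (m M : nat) (w : 'I_M -> R)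
    (a : 'I_M -> 'rV[R]_m) (A : set 'rV[R]_m) :
  \sum_l w l = 1 -> (forall l, A (a l)) -> discrete_law w a A = 1%E.
Proof.
move=> w1 Aa; rewrite /discrete_law.
under eq_bigr do rewrite diracE mem_set// mule1.
by rewrite sumEFin w1.
Qed.

(** * Weak and strong duality for the worst-case CVaR *)

(** The dual inequalities bound the hinge at [xi] by a function of the atom plus the weighted costs.
    Integrating against a plan and using its first marginal and cost bounds gives at most
    [tau * alpha]. Multipliers are extended reals so that both programs are covered. *)
Lemma cvar_weak_duality (R : realType) (n : nat) (d : 'I_n -> nat) (M : nat)
    (Nb : forall k : 'I_n, 'rV[R]_(d k) -> R)
    (Xi : set (blockvec R d)) (p : R) (a : 'I_M -> blockvec R d) (w : 'I_M -> R)
    (eps : 'I_n -> R) (h : blockvec R d -> R) (alpha tau : R)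
    (lam : 'I_n -> \bar R) (s : 'I_M -> R)
    (P : probability (borel (blockvec R d)) R) :
  (forall k, is_norm (Nb k)) -> closed Xi -> (forall l, Xi (a l)) ->
  (forall l, 0 < w l) -> \sum_l w l = 1 ->
  {within Xi, continuous h} ->
  (forall k, 0 <= lam k)%E -> (forall l, 0 <= s l) ->
  (\sum_k lam k * (eps k `^ p)%:E + (\sum_l w l * s l)%:E
     <= (tau * alpha)%:E)%E ->
  (forall l xi, Xi xi -> (h xi + tau)%:E
     - \sum_k lam k * (block_cost Nb p k xi (a l))%:E <= (s l)%:E)%E ->
  multi_transport Nb Xi p (discrete_law w a) eps P ->
  (cvar_functional Xi P h alpha <= 0)%E.
Proof.
move=> hNb cXi Xia w0 w1 ch lam0 s0 budget dual [pi [piX piQ piP pieps]].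
have mXi : measurable (Xi : set (borel (blockvec R d))).
  exact: closed_borel_measurable.
have w0' l : 0 <= w l by exact: ltW.
have [mQ mQE _] := discrete_measure_exists
  (a : 'I_M -> borel (blockvec R d)) w0'.
pose A0 : set (borel (blockvec R d)) := range a.
have finA : finite_set A0 by exact: finite_image.
have m1 (b : blockvec R d) : measurable ([set b] : set (borel (blockvec R d))).
  exact: measurable_borel_set1.
have mA : measurable A0.
  rewrite /A0 -bigcup_imset1; apply: fin_bigcup_measurable => [|l _].
    exact: finite_finset.
  exact: (m1 (a l)).
pose D : set (borel (blockvec R d) * borel (blockvec R d)) := A0 `*` Xi.
have mD : measurable D by exact: measurableX.
pose G xi := Num.max (h xi + tau) 0.
have mG : measurable_fun (Xi : set (borel (blockvec R d))) G.
  exact: hinge_measurable.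
have mGE : measurable_fun (Xi : set (borel (blockvec R d))) (fun xi => (G xi)%:E).
  exact/measurable_EFinP.
have G0 xi : 0 <= G xi by rewrite /G le_max lexx orbT.
(* The atoms need not be distinct, so s l must be replaced by a function of the
   atom before integrating. *)
pose sigma (z : borel (blockvec R d)) : \bar R :=
  ereal_inf [set (s l)%:E | l in [set l | a l = z]].
have sigma0 z : (0 <= sigma z)%E.
  by apply: le_ereal_inf_tmp => _ [l _ <-]; rewrite lee_fin.
have sigma_le l : (sigma (a l) <= (s l)%:E)%E.
  by apply: ereal_inf_lbound; exists l.
pose cost k (z : borel (blockvec R d) * borel (blockvec R d)) :=
  (block_cost Nb p k z.1 z.2)%:E.
have cost0 k z : (0 <= cost k z)%E by rewrite lee_fin powR_ge0.
have mcost k : measurable_fun D (cost k).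
  apply: measurable_fun_finite_fst => // b _.
  exact: block_cost_measurable.
have mfst : measurable_fun D (fun z => sigma z.1).
  by apply: measurable_fun_finite_fst => // b _ /=; exact: measurable_cst.
have mlam k : measurable_fun D (fun z => lam k * cost k z)%E.
  exact: measurable_funeM.
have msum : measurable_fun D (fun z => \sum_k lam k * cost k z)%E.
  exact: emeasurable_sum.
have lamcost0 k z : (0 <= lam k * cost k z)%E by exact: mule_ge0.
have sum0 z : (0 <= \sum_k lam k * cost k z)%E by exact: sume_ge0.
have pointwise z : D z -> ((G z.2)%:E <= sigma z.1 + \sum_k lam k * cost k z)%E.
  case: z => _ xi [/= [l _ <-] Xxi].
  (* If the weighted cost is infinite the bound is trivial. Otherwise it is checked for every index
     sharing this atom, hence for the infimum [sigma]. *)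
  have := sum0 (a l, xi); case E : (\sum_k _)%E => [r| |]// r0; last first.
    by rewrite addey ?leey// gt_eqF// (lt_le_trans _ (sigma0 _)).
  rewrite -leeBlDr//; apply: le_ereal_inf_tmp => _ [l' /= al <-].
  have := dual l' xi Xxi; rewrite al.
  under eq_bigr do rewrite /block_cost is_norm_distC//.
  rewrite -/(\sum_k lam k * cost k (a l, xi))%E.
  rewrite E -!EFinB !lee_fin => le_s.
  rewrite lerBlDr /G ge_max -lerBlDr le_s/=.
  by rewrite addr_ge0// -lee_fin.
have mfst' : measurable_fun setT (fst : borel (blockvec R d) * borel (blockvec R d) -> _).
  exact: measurable_fst.
have msnd' : measurable_fun setT (snd : borel (blockvec R d) * borel (blockvec R d) -> _).
  exact: measurable_snd.
pose N0 : set (borel (blockvec R d) * borel (blockvec R d)) := fst @^-1` (~` A0).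
have mN0 : measurable N0.
  by rewrite -[N0]setTI; apply: mfst' => //; exact: measurableC.
have piN0 : pi N0 = 0.
  have := piQ _ (measurableC mA); rewrite /pushforward -/N0 => ->.
  rewrite /discrete_law big1// => l _.
  by rewrite diracE memNset ?mule0// => /(_ _); apply; exists l.
have snd_mXi : measurable (snd @^-1` Xi :
    set (borel (blockvec R d) * borel (blockvec R d))).
  by rewrite -[X in measurable X]setTI; exact: msnd'.
have intG : (\int[P]_(xi in Xi) (G xi)%:E <= (tau * alpha)%:E)%E.
  rewrite (ge0_integral_image_law msnd' piP mXi); last 2 first.
  - exact: mGE.
  - by move=> xi _; rewrite lee_fin.
  (* The first marginal is carried by the atoms, so the plan does not charge [N0] and the domain
     shrinks to [D], where [pointwise] holds. *)
  rewrite (ge0_negligible_integral mN0)//; last 2 first.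
  - by apply: (measurable_comp mXi _ mGE (measurable_funTS msnd')) => _ [z Xz <-].
  - by move=> z _; rewrite lee_fin.
  have -> : snd @^-1` Xi `\` N0 = D.
    apply/seteqP; split => [z [/= Xz /contrapT Az]|z [Az Xz]]; first by split.
    by split => //; apply.
  apply: (@le_trans _ _ (\int[pi]_(z in D) (sigma z.1 + \sum_k lam k * cost k z))%E).
    apply: ge0_integral_subset_le => z Dz.
    - by split => //; exact: pointwise.
    - by rewrite lee_fin.
    - by rewrite adde_ge0.
  rewrite ge0_integralD// ge0_integral_sum//.
  apply: le_trans budget; rewrite addeC; apply: leeD.
    apply: lee_sum => k _; rewrite ge0_integralZl//.
    apply: lee_wpmul2l => //; apply: le_trans (pieps k).
    apply: ge0_integral_subset_le => z.
    - by case=> -[l _ al] Xz; split; [split => //; rewrite -al|].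
    - by move=> _; exact: cost0.
    - by move=> _; rewrite lee_fin powR_ge0.
  (* On the full cylinder over the atoms, the integral of [sigma] depends only on the first
     marginal. *)
  apply: (@le_trans _ _ (\int[pi]_(z in fst @^-1` A0) (sigma z.1))%E).
    by apply: ge0_integral_subset_le => // z [].
  rewrite -(ge0_integral_image_law (nu := mQ) mfst' _ mA)//; last 2 first.
  - by move=> B mB; rewrite piQ// mQE.
  - exact: measurable_fun_finite_set.
  rewrite (discrete_integral w0' (fun B _ => mQE B))//; last first.
    exact: measurable_fun_finite_set.
  rewrite -sumEFin; apply: lee_sum => l _; rewrite EFinM lee_wpmul2l//.
    by rewrite lee_fin.
  by rewrite diracE mem_set ?mul1e//; exists l.
apply: (@le_trans _ _ (\int[P]_(xi in Xi) (G xi - tau * alpha)%:E)%E).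
  by apply: ereal_inf_lbound; exists tau.
rewrite probability_integral_shift//.
- by rewrite sube_le0.
- rewrite -(piP _ mXi) /pushforward; apply/eqP; rewrite eq_le.
  apply/andP; split; first exact: probability_le1.
  rewrite -piX; apply: le_measure => [||z []//]; apply/mem_set => //.
  exact: measurableX.
- by apply: le_lt_trans intG _; rewrite ltry.
Qed.

(** This is [selection_duality] with the block costs. A mixture of selections defines a plan moving
    mass [v j * w l] from [a l] to [xi j l], so its second marginal lies in the ambiguity set. *)
Lemma cvar_strong_duality (R : realType) (n : nat) (d : 'I_n -> nat) (M : nat)
    (Nb : forall k : 'I_n, 'rV[R]_(d k) -> R)
    (Xi : set (blockvec R d)) (p : R) (a : 'I_M -> blockvec R d) (w : 'I_M -> R)
    (eps : 'I_n -> R) (h : blockvec R d -> R) (alpha : R) :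
  (forall k, is_norm (Nb k)) -> 1 <= p -> closed Xi -> (forall l, Xi (a l)) ->
  (forall l, 0 < w l) -> \sum_l w l = 1 -> (forall k, 0 <= eps k) ->
  0 < alpha < 1 -> {within Xi, continuous h} ->
  (forall P, multi_transport Nb Xi p (discrete_law w a) eps P ->
     (cvar_functional Xi P h alpha <= 0)%E) ->
  exists (tau : R) (lam : 'I_n -> R) (s : 'I_M -> R),
    [/\ forall k, 0 <= lam k, forall l, 0 <= s l,
    \sum_k lam k * eps k `^ p + \sum_l w l * s l <= tau * alpha
  & forall l xi, Xi xi ->
      (forall k, eps k = 0 -> block_cost Nb p k xi (a l) = 0) ->
      h xi + tau - \sum_k lam k * block_cost Nb p k xi (a l) <= s l].
Proof.
move=> hNb p1 cXi Xia w0 w1 eps0 alpha01 ch primal.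
have p0 : p != 0 by rewrite gt_eqF// (lt_le_trans _ p1).
have mXi : measurable (Xi : set (borel (blockvec R d))).
  exact: closed_borel_measurable.
(* A zero radius leaves no budget for its block, so admissible points must agree there with the
   atom. *)
pose Xi_ l := [set xi | Xi xi /\
  forall k, eps k = 0 -> block_cost Nb p k xi (a l) = 0].
pose c k l xi := block_cost Nb p k xi (a l).
have ca k l : c k l (a l) = 0.
  by rewrite /c /block_cost subrr is_norm0// powR0.
have [k|l|k /eqP|J v xi v0 v1 Xxi cost_le dl dl0|tau [lam [s [lam0 s0 budget dual]]]] :=
  @selection_duality R n M (blockvec R d) Xi_ w h c (fun k => eps k `^ p) alpha a
    w0 w1 alpha01 _ ca.
- exact: powR_ge0.
- by split => // k _; exact: ca.
- by rewrite powR_eq0 p0 andbT => /eqP ek l x [_]; exact.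
- pose JJ : finType := (J * 'I_M)%type.
  pose V (j : JJ) := v j.1 * w j.2.
  have V0 j : 0 <= V j by rewrite mulr_ge0// ltW.
  have sumV (F : JJ -> R) :
      \sum_j V j * F j = \sum_j v j * \sum_l w l * F (j, l).
    under [RHS]eq_bigr do rewrite mulr_sumr.
    by rewrite pair_big; apply: eq_bigr => -[j l] _; rewrite mulrA.
  have V1 : \sum_j V j = 1.
    under eq_bigr do rewrite -[V _]mulr1.
    rewrite sumV -[RHS]v1; apply: eq_bigr => j _.
    by under eq_bigr do rewrite mulr1; rewrite w1 mulr1.
  pose pt (j : JJ) : borel (blockvec R d) * borel (blockvec R d) :=
    (a j.2, xi j.1 j.2).
  have [pi piE] := @discrete_probability_exists _ _ R _ V pt V0 V1.
  have [P PE] := @discrete_probability_exists _ (borel (blockvec R d)) R _ V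
    (fun j => xi j.1 j.2) V0 V1.
  have PXi : P Xi = 1%E.
    rewrite PE -V1 -sumEFin; apply: eq_bigr => j _.
    by rewrite diracE mem_set ?mule1//; have [] := Xxi j.1 j.2.
  have hP : multi_transport Nb Xi p (discrete_law w a) eps P.
    exists pi; split.
    + rewrite piE -V1 -sumEFin; apply: eq_bigr => j _.
      by rewrite diracE mem_set ?mule1//; split => //=; have [] := Xxi j.1 j.2.
    + move=> A mA; rewrite /pushforward piE /discrete_law.
      transitivity (\sum_(j : JJ) (V j * (a j.2 \in A)%:R)%:E)%E.
        by apply: eq_bigr => -[j l] _; rewrite EFinM.
      rewrite sumEFin sumV /= -mulr_suml v1 mul1r -sumEFin.
      by apply: eq_bigr => l _; rewrite EFinM.
    + by move=> A mA; rewrite /pushforward piE PE.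
    + move=> k; apply: le_trans (_ : _ <= (\sum_j v j * \sum_l w l * c k l (xi j l))%:E)%E _; last first.
        by rewrite lee_fin.
      (* Only an upper bound is required, and [discrete_integral_le] gives it without joint
         measurability of the cost. *)
      apply: le_trans (discrete_integral_le _ V0 _ (fun A _ => piE A) _) _.
      * move=> j; rewrite (_ : [set pt j] = [set a j.2] `*` [set xi j.1 j.2]).
          by apply: measurableX; exact: measurable_borel_set1.
        by apply/seteqP; split => [_ ->|[? ?] [/= -> ->]].
      * by move=> z; rewrite lee_fin powR_ge0.
      rewrite (_ : (\sum_j _)%E =
        (\sum_j V j * block_cost Nb p k (a j.2) (xi j.1 j.2))%:E); last first.
        by rewrite -sumEFin; apply: eq_bigr => j _; rewrite EFinM.
      rewrite lee_fin sumV /=; apply: ler_sum => j _.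
      rewrite ler_wpM2l//; apply: ler_sum => l _.
      by rewrite ler_wpM2l ?(ltW (w0 l))// /c /block_cost is_norm_distC.
  (* The infimum over [tau] need not be known to be attained; being below [dl], it provides a [tau]
     with value below [dl]. *)
  have /le_lt_trans/(_ (_ : 0 < dl%:E)%E) : (cvar_functional Xi P h alpha <= 0)%E.
    exact: primal.
  rewrite lte_fin => /(_ dl0)/ereal_inf_lt[_ [tau _ <-]] tau_lt; exists tau.
  pose G x := Num.max (h x + tau) 0.
  have G0 x : 0 <= G x by rewrite /G le_max lexx orbT.
  have mG : measurable_fun (Xi : set (borel (blockvec R d))) G.
    exact: hinge_measurable.
  have intG : (\int[P]_(x in Xi) (G x)%:E =
      (\sum_j v j * \sum_l w l * G (xi j l))%:E)%E.
    rewrite (discrete_integral V0 (fun A _ => PE A))//; last 2 first.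
    + exact/measurable_EFinP.
    + by move=> x _; rewrite lee_fin.
    rewrite -(sumV (fun j => G (xi j.1 j.2))) -sumEFin.
    apply: eq_bigr => j _; rewrite diracE mem_set ?mul1e//.
    by have [] := Xxi j.1 j.2.
  move: tau_lt; rewrite (probability_integral_shift _ mXi PXi mG)// intG ?ltry//.
exists tau, lam, s; split => // l x Xx cx; exact: dual.
Qed.

(** * Convexity of the program and equivalence of the problems *)

Lemma ereal_sup_image_leP (R : realType) (T : Type) (D : set T)
    (F : T -> \bar R) (y : \bar R) :
  (ereal_sup [set F x | x in D] <= y)%E <-> forall x, D x -> (F x <= y)%E.
Proof.
split=> [Fy x Dx|Fy]; last by apply: ge_ereal_sup => _ [x Dx <-]; exact: Fy.
by apply: le_trans Fy; apply: ereal_sup_ubound; exists x.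
Qed.

Lemma equivalent_problemsP (R : realType) (V W : Type) (obj : V -> R)
    (F : set V) (proj : W -> V) (G : set W) :
  (forall x, F x -> exists2 z, G z & proj z = x) ->
  (forall z, G z -> F (proj z)) ->
  equivalent_problems obj F proj G.
Proof.
move=> FG GF; split=> [x|].
  by split=> [/FG//|[z Gz <-]]; exact: GF.
congr ereal_inf; apply/seteqP; split => [_ [x /FG[z Gz <-] <-]|_ [z Gz <-]].
  by exists z.
by exists (proj z) => //; exact: GF.
Qed.

(** Every constraint is jointly convex: the budget is linear, and for each [xi] the term under the
    supremum is convex in [x] and affine in the multipliers and [tau]. *)
Lemma program_feasible_convex (R : realType) (n : nat) (d : 'I_n -> nat)
    (q I M : nat) (Nb : forall k, 'rV[R]_(d k) -> R)
    (X : set 'rV[R]_q) (Xi : set (blockvec R d)) (p : R)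
    (eps : 'I_n -> R) (w : 'I_M -> R) (a : 'I_M -> blockvec R d)
    (f : 'I_I -> 'rV[R]_q -> blockvec R d -> R) (alpha : 'I_I -> R) :
  convex_set X ->
  (forall i xi, Xi xi -> convex_function X (fun x => f i x xi)) ->
  convex_set (program_feasible Nb X Xi p eps w a f alpha).
Proof.
move=> Xcvx fcvx [[[x1 t1] l1] s1] [[[x2 t2] l2] s2] t.
move=> /set_mem[X1 L1 B1 D1 S1] /set_mem[X2 L2 B2 D2 S2]; apply/mem_set.
have t0 : 0 <= t%:num by [].
have u0 : 0 <= 1 - t%:num by rewrite subr_ge0.
split.
- by apply/set_mem; apply: Xcvx; exact/mem_set.
- by move=> k i; rewrite !mxE addr_ge0// mulr_ge0.
- move=> i; rewrite !mxE.
  have := lerD (ler_wpM2l t0 (B1 i)) (ler_wpM2l u0 (B2 i)).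
  rewrite !mulrDr !mulrDl !mulrA; apply: le_trans.
  rewrite addrACA !mulr_sumr -!big_split/=.
  rewrite le_eqVlt; apply/orP; left; apply/eqP; congr (_ + _).
    by apply: eq_bigr => k _; rewrite !mxE /unstable.onem; ring.
  by apply: eq_bigr => k _; rewrite !mxE /unstable.onem; ring.
- move=> l i; apply/ereal_sup_image_leP => xi Xxi; rewrite !mxE lee_fin.
  have /ereal_sup_image_leP/(_ _ Xxi) := D1 l i; rewrite lee_fin => {}D1.
  have /ereal_sup_image_leP/(_ _ Xxi) := D2 l i; rewrite lee_fin => {}D2.
  have := lerD (ler_wpM2l t0 D1) (ler_wpM2l u0 D2); apply: le_trans.
  have := fcvx i xi Xxi t _ _ (mem_set X1) (mem_set X2); rewrite convRE /=.
  pose c k := Nb k (submxrow xi k - submxrow (a l) k) `^ p.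
  rewrite [X in _ -> _ - X <= _](_ : _ =
      t%:num * (\sum_k l1 k i * c k) + (1 - t%:num) * (\sum_k l2 k i * c k)); last first.
    rewrite !mulr_sumr -big_split/=; apply: eq_bigr => k _.
    by rewrite !mxE /unstable.onem /c; ring.
  rewrite /c /unstable.onem; set sum1 := \sum_k _; set sum2 := \sum_k _.
  by move=> fle; lra.
- by move=> l i; rewrite !mxE addr_ge0// mulr_ge0.
Qed.

(* A multiplier +oo, on the blocks with eps k = 0, forces the block cost to be 0. *)
Lemma extended_multiplier_dual (R : realType) (n : nat) (eps lam c : 'I_n -> R)
    (u s : R) :
  (forall k, 0 <= lam k) -> (forall k, 0 <= c k) ->
  ((forall k, eps k = 0 -> c k = 0) -> u - \sum_k lam k * c k <= s) ->
  (u%:E - \sum_k (if (eps k == 0)%R then +oo else (lam k)%:E) * (c k)%:E <= s%:E)%E.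
Proof.
move=> lam0 c0 H.
have [ec|/existsNP[k /not_implyP[ek ck]]] := pselect (forall k, eps k = 0 -> c k = 0).
  rewrite (_ : (\sum_k _)%E = (\sum_k lam k * c k)%:E) ?lee_fin ?H//.
  rewrite -sumEFin; apply: eq_bigr => k _.
  by case: eqP => // ek; rewrite (ec k ek) mule0 mulr0.
rewrite (bigD1 k)//= ek eqxx gt0_mulye ?lte_fin ?lt_neqAle 1?eq_sym ?c0 ?andbT//.
  rewrite addye ?leNye// gt_eqF// (lt_le_trans (ltNyr 0))//.
  apply: sume_ge0 => j _; apply: mule_ge0; last by rewrite lee_fin.
  by case: ifP => _ //; rewrite lee_fin.
exact/eqP.
Qed.

Theorem corollary7p4 (R : realType) (n : nat) (d : 'I_n -> nat) (q I M : nat)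
    (N : blockvec R d -> R) (Nb : forall k : 'I_n, 'rV[R]_(d k) -> R)
    (hN : is_norm N) (hNb : forall k, is_norm (Nb k))
    (p : R) (hp : 1 <= p)
    (hI : (0 < I)%N) (alpha : 'I_I -> R) (halpha : forall i, 0 < alpha i < 1)
    (g : 'rV[R]_q)
    (X : set 'rV[R]_q) (Xclosed : closed X) (Xconvex : convex_set X)
    (Xi : set (blockvec R d)) (Xiclosed : closed Xi)
    (a : 'I_M -> blockvec R d) (ha : forall l, Xi (a l))
    (w : 'I_M -> R) (w_gt0 : forall l, 0 < w l) (w_sum1 : \sum_l w l = 1)
    (eps : 'I_n -> R) (eps_ge0 : forall k, 0 <= eps k)
    (f : 'I_I -> 'rV[R]_q -> blockvec R d -> R)
    (fconvex : forall i xi, Xi xi -> convex_function X (fun x => f i x xi))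
    (fgrowth : exists2 r : R, 0 <= r < p &
       forall i x, X x ->
         {within Xi, continuous (f i x)} /\ growth_class N Xi r (f i x)) :
  let objective (x : 'rV[R]_q) := \sum_j g 0 j * x 0 j in
  let dr_cvar := dr_cvar_feasible X Xi
    (multi_transport Nb Xi p (discrete_law w a) eps) f alpha in
  let program := program_feasible Nb X Xi p eps w a f alpha in
  let extended_program :=
    extended_program_feasible Nb X Xi p eps w a f alpha in
  [/\ convex_set program,
      (forall k, 0 < eps k) ->
        equivalent_problems objective dr_cvar (fun z => z.1.1.1) program
    & equivalent_problems objective dr_cvar
        (fun z => z.1.1.1) extended_program].
Proof.
move=> objective dr_cvar program extended_program.
have fcont i x : X x -> {within Xi, continuous (f i x)}.
  by have [r _ H] := fgrowth => /H - /(_ i)[].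
have extended_sound z : extended_program z -> dr_cvar z.1.1.1.
  case: z => [[[x tau] lam] s] [/= Xx lam0 budget dual s0]; split => // i.
  apply/ereal_sup_image_leP => P hP.
  apply: (cvar_weak_duality (lam := lam ^~ i) (s := s ^~ i) (tau := tau 0 i)
    hNb Xiclosed ha w_gt0 w_sum1 _ _ _ _ _ hP) => //.
  - exact: fcont.
  - by move=> l; exact/ereal_sup_image_leP/dual.
(* Real multipliers embed into the extended ones, which reduces this to the extended program. *)
have program_sound z : program z -> dr_cvar z.1.1.1.
  case: z => [[[x tau] lam] s] [/= Xx lam0 budget dual s0].
  apply: (extended_sound (x, tau, map_mx EFin lam, s)); split => //=.
  - by move=> k i; rewrite mxE lee_fin.
  - move=> i; apply: le_trans (_ : _ <= (\sum_k lam k i * eps k `^ p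
      + \sum_l w l * s l i)%:E)%E _; last by rewrite lee_fin.
    rewrite EFinD leeD2r// -sumEFin; apply: lee_sum => k _.
    by rewrite mxE EFinM.
  - move=> l i; apply/ereal_sup_image_leP => xi Xxi.
    have /ereal_sup_image_leP/(_ _ Xxi) := dual l i; apply: le_trans.
    rewrite EFinB; apply: leeB => //; rewrite -sumEFin; apply: lee_sum => k _.
    by rewrite mxE EFinM.
have strong x : dr_cvar x -> exists (tau : 'I_I -> R) (lam : 'I_I -> 'I_n -> R)
    (s : 'I_I -> 'I_M -> R), forall i,
  [/\ forall k, 0 <= lam i k, forall l, 0 <= s i l,
    \sum_k lam i k * eps k `^ p + \sum_l w l * s i l <= tau i * alpha i
  & forall l xi, Xi xi ->
      (forall k, eps k = 0 -> block_cost Nb p k xi (a l) = 0) ->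
      f i x xi + tau i - \sum_k lam i k * block_cost Nb p k xi (a l) <= s i l].
  move=> [Xx cvar_le0].
  have /choice[tau /choice[lam /choice[s H]]] i :=
    cvar_strong_duality hNb hp Xiclosed ha w_gt0 w_sum1 eps_ge0 (halpha i)
      (fcont i x Xx) (proj1 (ereal_sup_image_leP _ _ _) (cvar_le0 i)).
  by exists tau, lam, s.
split; first exact: program_feasible_convex.
(* With all radii positive, the restriction to points agreeing with the atom on zero-radius blocks
   is vacuous, so the real multipliers serve directly. *)
- move=> eps_gt0; apply: equivalent_problemsP => // x drx.
  have [tau [lam [s H]]] := strong _ drx.
  exists (x, \row_i tau i, \matrix_(k, i) lam i k, \matrix_(l, i) s i l) => //.
  split; first by case: drx.
  + by move=> k i; rewrite mxE; have [] := H i.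
  + move=> i; rewrite mxE; have [_ _ + _] := H i; congr (_ + _ <= _).
      by apply: eq_bigr => k _; rewrite mxE.
    by apply: eq_bigr => l _; rewrite mxE.
  + move=> l i; apply/ereal_sup_image_leP => xi Xxi; rewrite !mxE lee_fin.
    under eq_bigr do rewrite mxE.
    have [_ _ _] := H i; apply => // k ek.
    by have := eps_gt0 k; rewrite ek ltxx.
  + by move=> l i; rewrite mxE; have [] := H i.
- apply: equivalent_problemsP => // x drx.
  have [tau [lam [s H]]] := strong _ drx.
  (* The value [+oo] on zero-radius blocks costs [+oo * 0 = 0] in the budget and removes all points
     not covered by [strong]. *)
  pose lam' : 'M[\bar R]_(n, I) :=
    \matrix_(k, i) if eps k == 0 then +oo%E else (lam i k)%:E.
  exists (x, \row_i tau i, lam', \matrix_(l, i) s i l) => //.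
  split; first by case: drx.
  + move=> k i; rewrite mxE; case: ifP => // _; rewrite lee_fin.
    by have [] := H i.
  + move=> i; rewrite mxE; have [_ _ budget _] := H i.
    under [in X in (_ + X)%E]eq_bigr do rewrite mxE.
    apply: le_trans (_ : _ <= (\sum_k lam i k * eps k `^ p
      + \sum_l w l * s i l)%:E)%E _; last by rewrite lee_fin.
    rewrite EFinD leeD2r// -sumEFin; apply: lee_sum => k _; rewrite mxE.
    case: eqP => [->|_]; last by rewrite EFinM.
    by rewrite powR0 ?mule0 ?mulr0// gt_eqF// (lt_le_trans _ hp).
  + move=> l i; apply/ereal_sup_image_leP => xi Xxi; rewrite !mxE.
    under eq_bigr do rewrite mxE.
    have [lam0 _ _ dual] := H i.
    apply: (@extended_multiplier_dual _ _ eps (lam i)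
      (fun k => block_cost Nb p k xi (a l))) => //; last exact: dual.
    by move=> k; exact: powR_ge0.
  + by move=> l i; rewrite mxE; have [] := H i.
Qed.
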